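(* Let $\mathcal{H}=(V(\mathcal{H}),E(\mathcal{H}))$ be an $m$-uniform hypergraph with $n$ vertices and let $j\in V(\mathcal{H})$. Then the subgraph centrality of $j$ in $\mathcal{H}$ is $$C(j)=\sum_{d=0}^{\infty}\frac{\mu_{d}(j)}{d!},$$ where $\mu_0(j)=(m-1)^{n-1}$ and, for every integer $d\geq 1$, $$\mu_{d}(j)=(m-1)^{n-1}\sum_{F\in\mathcal{F}_{d}^{(j)}(\mathcal{H})}\frac{b(F)}{c(F)}\,|\mathbf{W}(F,j)|.$$ Here $b(F)$ is the product of the factorials of the multiplicities of all the arcs in $D(F)$, $c(F)$ is the product of the factorials of the outdegrees of all the vertices in $D(F)$, and $\mathbf{W}(F,j)$ is the set of all Eulerian closed walks of $D(F)$ starting and ending at the vertex $j$.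
   Context: Write $[n]=\{1,\dots,n\}$. A hypergraph $\mathcal{H}=(V(\mathcal{H}),E(\mathcal{H}))$ (here with $V(\mathcal{H})=[n]$, and $E(\mathcal{H})$ a set of subsets of $V(\mathcal{H})$) is $m$-uniform if $|e|=m\geq 2$ for every $e\in E(\mathcal{H})$; a word $i_1i_2\cdots i_m$ is said to belong to $E(\mathcal{H})$ if $\{i_1,\dots,i_m\}\in E(\mathcal{H})$. Its adjacency tensor $\mathcal{A}_{\mathcal{H}}=(h_{\alpha})_{\alpha\in[n]^m}$ has $h_\alpha=\frac{1}{(m-1)!}$ if $\alpha\in E(\mathcal{H})$ and $h_\alpha=0$ otherwise. Definition of $\mu_d(j)$ and $C(j)$. Let $A=(a_{ij})$ be an $n\times n$ auxiliary matrix whose entries are independent variables, and for $i\in[n]$, $\alpha=i_2\cdots i_m\in[n]^{m-1}$ put $\frac{\partial}{\partial a_{i\alpha}}=\frac{\partial}{\partial a_{ii_2}}\cdots\frac{\partial}{\partial a_{ii_m}}$. For $j\in[n]$ and an integer $d\ge 0$, $$\mu_{d}(j)=(m-1)^{n-1}\sum_{d_1+\cdots+d_n=d}\ \prod_{i=1}^{n}\frac{1}{(d_i(m-1))!}\Big(\sum_{\alpha_i\in[n]^{m-1}}h_{i\alpha_i}\frac{\partial}{\partial a_{i\alpha_i}}\Big)^{d_i}\,(A^{d(m-1)})_{jj},$$ the sum being over nonnegative integers $d_1,\dots,d_n$. The subgraph centrality of the vertex $j$ is $C(j)=\sum_{d=0}^{\infty}\frac{\mu_d(j)}{d!}$ with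 this $\mu_d(j)$. Multi-digraphs. For $d\geq 1$ let $\mathcal{F}_d=\{(i_1\alpha_1,\dots,i_d\alpha_d)\mid 1\le i_1\le\cdots\le i_d\le n,\ \alpha_k\in[n]^{m-1},\ k=1,\dots,d\}$. For $F=(i_1\alpha_1,\dots,i_d\alpha_d)\in\mathcal{F}_d$ with $\alpha_k=j_1^{(k)}\cdots j_{m-1}^{(k)}$, let $\widetilde{E}(F)$ be the multiset of arcs consisting of $(i_k,j_1^{(k)}),\dots,(i_k,j_{m-1}^{(k)})$ for $k=1,\dots,d$ (multiplicities added), and let $D(F)$ be the multi-digraph with arc multiset $\widetilde{E}(F)$ and with vertex set the set of endpoints of these arcs. Let $\omega(u,v)$ be the multiplicity of the arc $(u,v)$ in $D(F)$, and let $\widehat{D}(F)$ be the digraph obtained from $D(F)$ by removing duplicate arcs. Outdegrees in $D(F)$ count arcs with multiplicity. An Eulerian closed walk of $D(F)$ is a closed walk that uses each arc $(u,v)$ of $\widehat{D}(F)$ exactly $\omega(u,v)$ times (so parallel arcs are not distinguished; a walk is determined by its sequence of vertices, including its starting vertex). $D(F)$ is Eulerian if it has Eulerian closed walks. A word $i_1\cdots i_s$ is in ascending order if $i_1\le\cdots\le i_s$. Let $\mathcal{F}_d(\mathcal{H})$ be the set of $(i_1\alpha_1,\dots,i_d\alpha_d)\in\mathcal{F}_d$ such that $i_k\alpha_k\in E(\mathcal{H})$ and $\alpha_k$ is in ascending order for all $k=1,\dots,d$, and let $\mathcal{F}_d^{(j)}(\mathcal{H})$ be the set of $F\in\mathcal{F}_d(\mathcal{H})$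 such that $D(F)$ is Eulerian and contains the vertex $j$. *)

(* Defs.v *)
From HB Require Import structures.
From mathcomp Require Import all_boot all_order all_algebra.
From mathcomp Require mpoly.

Set Implicit Arguments.
Unset Strict Implicit.
Unset Printing Implicit Defensive.

Import Order.TTheory GRing.Theory Num.Theory.

Local Open Scope ring_scope.

(* The vertex set [n] is 'I_n, with its usual order. *)
Definition uniform_hypergraph (n m : nat) (E : {set {set 'I_n}}) : Prop :=
  (2 <= m)%N /\ forall e : {set 'I_n}, e \in E -> #|e| = m.

Definition word_in (n : nat) (E : {set {set 'I_n}}) (w : seq 'I_n) : bool :=
  [set x in w] \in E.

(* A tensor indexed by [n]^m, m >= 1, is given in curried form: [h i alpha] is
   the entry at the word i alpha, where alpha has length m - 1. *)
Definition tensor (R : Type) (n m : nat) : Type :=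
  'I_n -> (m.-1).-tuple 'I_n -> R.

Definition adjacency_tensor (R : fieldType) (n m : nat) (E : {set {set 'I_n}}) :
    tensor R n m :=
  fun i alpha => if word_in E (i :: alpha) then (m.-1)`!%:R^-1 else 0.

Module DiffOp.
Import mpoly.

(* The variable a_{ij} is the indeterminate with index [mxvec_index i j]. *)
Definition aux_matrix (R : fieldType) (n : nat) : 'M[{mpoly R[n * n]}]_n :=
  \matrix_(i, j) 'X_(mxvec_index i j).

Definition word_deriv (R : fieldType) (n : nat) (i : 'I_n) (alpha : seq 'I_n)
    (p : {mpoly R[n * n]}) : {mpoly R[n * n]} :=
  foldr (fun k q => mderiv (mxvec_index i k) q) p alpha.

Definition tensor_deriv (R : fieldType) (n m : nat) (h : tensor R n m)
    (i : 'I_n) (p : {mpoly R[n * n]}) : {mpoly R[n * n]} :=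
  \sum_(alpha : (m.-1).-tuple 'I_n) h i alpha *: word_deriv i alpha p.

(* The product over i of the (commuting) differential operators
   ((d_i (m-1))!)^-1 (sum_alpha h_{i alpha} d/da_{i alpha})^{d_i}. *)
Definition multi_deriv (R : fieldType) (n m : nat) (h : tensor R n m)
    (ds : 'I_n -> nat) (p : {mpoly R[n * n]}) : {mpoly R[n * n]} :=
  foldr (fun i q =>
           (ds i * m.-1)`!%:R^-1 *: iter (ds i) (tensor_deriv h i) q)
        p (enum 'I_n).

Definition mu_poly (R : fieldType) (n m : nat) (h : tensor R n m) (d : nat)
    (j : 'I_n) : {mpoly R[n * n]} :=
  \sum_(ds : {ffun 'I_n -> 'I_d.+1} | (\sum_i ds i)%N == d)
     multi_deriv h (fun i => ds i) ((aux_matrix R n ^+ (d * m.-1)) j j).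

(* [mu_poly] is a constant polynomial, see [mu_polyE]; [mu_sum] is its value. *)
Definition mu_sum (R : fieldType) (n m : nat) (h : tensor R n m) (d : nat)
    (j : 'I_n) : R :=
  mcoeff mnm0 (mu_poly h d j).

Section Constant.
Variables (R : fieldType) (n : nat).
Implicit Types (p q : {mpoly R[n * n]}) (k : nat).

Definition deg_le k p := forall mn : 'X_{1..n * n}, (k < mdeg mn)%N -> p@_mn = 0.

Lemma deg_le_sum k I (s : seq I) (P : pred I) (f : I -> {mpoly R[n * n]}) :
  (forall x, P x -> deg_le k (f x)) -> deg_le k (\sum_(x <- s | P x) f x).
Proof.
by move=> H mn lt; rewrite raddf_sum big1 //= => x /H ->.
Qed.

Lemma deg_leZ k c p : deg_le k p -> deg_le k (c *: p).
Proof. by move=> H mn lt; rewrite mcoeffZ H ?mulr0. Qed.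

Lemma deg_le_mderiv k i p : deg_le k p -> deg_le k.-1 (mderiv i p).
Proof.
move=> H mn lt; rewrite mcoeff_deriv H ?mul0rn // mdegD mdeg1 addn1.
by case: k lt {H}.
Qed.

Lemma deg_le_word k i (s : seq 'I_n) p :
  deg_le k p -> deg_le (k - size s) (word_deriv i s p).
Proof.
move=> H; elim: s => [|x s IH] /=; first by rewrite subn0.
by rewrite subnS; apply: deg_le_mderiv.
Qed.

Lemma deg_le_tensor m (h : tensor R n m) k i p :
  deg_le k p -> deg_le (k - m.-1) (tensor_deriv h i p).
Proof.
move=> H; apply: deg_le_sum => a _; apply: deg_leZ.
by rewrite -[X in (_ - X)%N](size_tuple a); apply: deg_le_word.
Qed.

Lemma deg_le_multi m (h : tensor R n m) ds k p :
  deg_le k p ->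
  deg_le (k - (\sum_i ds i) * m.-1) (multi_deriv h ds p).
Proof.
move=> H; rewrite /multi_deriv -big_enum /=.
elim: (enum _) => [|i s IH] /=; first by rewrite big_nil subn0.
apply: deg_leZ; rewrite big_cons mulnDl addnC subnDA.
elim: (ds i) => [|e IHe] /=; first by rewrite subn0.
by rewrite mulSn addnC subnDA; apply: deg_le_tensor.
Qed.

Lemma deg_leM k l p q : deg_le k p -> deg_le l q -> deg_le (k + l) (p * q).
Proof.
move=> Hp Hq mn lt; rewrite mcoeffM big1 // => -[a b] /= /eqP e.
have [la|la] := ltnP k (mdeg a); first by rewrite Hp ?mul0r.
have lab : (k + l < mdeg a + mdeg b)%N by rewrite -mdegD -e.
rewrite (Hq b) ?mulr0 // -(ltn_add2l k).
by apply: (leq_trans lab); rewrite leq_add2r.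
Qed.

Lemma deg_le_aux k (i j : 'I_n) : deg_le k ((aux_matrix R n ^+ k) i j).
Proof.
elim: k i j => [|k IH] i j.
  move=> mn lt; rewrite expr0 mxE; case: (i == j); rewrite ?mcoeff0 //.
  by rewrite mcoeff1 -mdeg_eq0 gtn_eqF.
rewrite exprS mxE; apply: deg_le_sum => l _; rewrite -(add1n k).
apply: deg_leM => // mn lt; rewrite mxE mcoeffX.
by case: eqP => // e; rewrite -e mdeg1 in lt.
Qed.

Lemma mu_polyE m (h : tensor R n m) d j :
  mu_poly h d j = (mu_sum h d j)%:MP.
Proof.
apply/mpolyP => mn; rewrite mcoeffC.
case: eqP => [->|/eqP ne]; first by rewrite mulr1.
rewrite mulr0; suff: deg_le 0 (mu_poly h d j) by apply; rewrite lt0n mdeg_eq0.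
apply: deg_le_sum => ds /eqP e.
by rewrite -(subnn (d * m.-1)) -{2}e; apply/deg_le_multi/deg_le_aux.
Qed.

End Constant.
End DiffOp.

(* Required only after the end of DiffOp: the notations of all_analysis and of
   mpoly cannot be active together. *)
From mathcomp Require Import all_classical all_reals all_analysis.
Import numFieldNormedType.Exports.
Import finset.

(* mu_d(j) of the adjacency tensor of the m-uniform hypergraph ([n], E). *)
Definition mu (R : realType) (n m : nat) (E : {set {set 'I_n}}) (d : nat)
    (j : 'I_n) : R :=
  (m.-1)%:R ^+ n.-1 * DiffOp.mu_sum (@adjacency_tensor R n m E) d j.

(* [limn] is a junk value on divergent sequences: convergence has to be stated
   where this is used. *)
Definition subgraph_centrality (R : realType) (n m : nat)
    (E : {set {set 'I_n}}) (j : 'I_n) : R :=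
  limn (series (fun d => mu R m E d j / d`!%:R)).

(* A list (i_1 alpha_1, ..., i_d alpha_d), not necessarily sorted. *)
Notation word_list n m d := (d.-tuple ('I_n * (m.-1).-tuple 'I_n)).

Definition ascending (n : nat) (w : seq 'I_n) : bool :=
  sorted (fun x y : 'I_n => (x <= y)%N) w.

Section Multidigraph.
Variables n m d : nat.
Implicit Types (F : word_list n m d) (v : 'I_n) (w : seq 'I_n).

(* The multiset of arcs of D(F), as a list. *)
Definition arcs F : seq ('I_n * 'I_n) :=
  flatten [seq [seq (t.1, k) | k <- tval t.2] |
             t : 'I_n * (m.-1).-tuple 'I_n <- F].

Definition arc_mult F (a : 'I_n * 'I_n) : nat := count_mem a (arcs F).

Definition vertices F : {set 'I_n} :=
  [set v | has (fun a => (a.1 == v) || (a.2 == v)) (arcs F)].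

Definition outdegree F v : nat := count (fun a => a.1 == v) (arcs F).

(* Arcs successively used by the walk with vertex sequence w. *)
Definition walk_arcs w : seq ('I_n * 'I_n) := zip w (behead w).

Definition closed_walk F w : bool :=
  if w is v :: s then path (fun x y => (x, y) \in arcs F) v s && (last v s == v)
  else false.

Definition eulerian_closed_walk F w : bool :=
  closed_walk F w &&
  [forall (a | a \in arcs F), count_mem a (walk_arcs w) == arc_mult F a].

(* D(F) has d (m-1) arcs, so an Eulerian closed walk has d (m-1) + 1 terms. *)
Definition eulerian F : bool :=
  [exists w : (d * m.-1).+1.-tuple 'I_n, eulerian_closed_walk F w].

Definition W F (j : 'I_n) : {set (d * m.-1).+1.-tuple 'I_n} :=
  [set w : (d * m.-1).+1.-tuple 'I_n |
    eulerian_closed_walk F w && (thead w == j)].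

Definition b F : nat := (\prod_(a : 'I_n * 'I_n | a \in arcs F) (arc_mult F a)`!)%N.

Definition c F : nat := (\prod_(v in vertices F) (outdegree F v)`!)%N.

Lemma size_arcs F : size (arcs F) = (d * m.-1)%N.
Proof.
rewrite size_flatten /shape -map_comp sumnE big_map /=.
under eq_bigr do rewrite size_map size_tuple.
by rewrite big_const_seq count_predT size_tuple iter_addn_0 mulnC.
Qed.

Lemma size_eulerian_closed_walk F w :
  eulerian_closed_walk F w -> size w = (d * m.-1).+1.
Proof.
case: w => // v s /andP[/andP[pF _] /forallP eF] /=; congr _.+1.
suff /perm_size : perm_eq (walk_arcs (v :: s)) (arcs F).
  by rewrite size_arcs size_zip /= => <-; symmetry; apply/minn_idPr.
apply/allP => a _; apply/eqP => /=.
have [aF|aF] := boolP (a \in arcs F); first by have := eF a; rewrite aF => /eqP.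
rewrite (count_memPn aF); apply/count_memPn; apply: contra aF.
rewrite /walk_arcs /=; elim: s v pF {eF} => //= x s IH v /andP[vx /IH {}IH].
by rewrite inE => /predU1P[->|].
Qed.

End Multidigraph.

Definition calF (n m d : nat) : {set word_list n m d} :=
  [set F : word_list n m d | ascending (unzip1 F)].

Definition calFH (n m d : nat) (E : {set {set 'I_n}}) : {set word_list n m d} :=
  [set F : word_list n m d in calF n m d |
    all (fun t : 'I_n * (m.-1).-tuple 'I_n =>
           word_in E (t.1 :: t.2) && ascending t.2) F].

Definition calFHj (n m d : nat) (E : {set {set 'I_n}}) (j : 'I_n) :
    {set word_list n m d} :=
  [set F : word_list n m d in calFH m d E | eulerian F & j \in vertices F].

(* Main.v *)
(* The tensor entries 1/(m-1)! cancel against the (m-1)! orderings of a word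
   alpha with distinct letters, so that sum_alpha h_{i alpha} d/da_{i alpha} is a
   sum over ascending alpha only.  Expanding the powers of these commuting
   operators, mu_d(j) / (m-1)^{n-1} is the sum over F in F_d(H) of 1/c(F) times
   the derivative of (A^{d(m-1)})_{jj} along the arcs of D(F): indeed the
   outdegree of i in D(F) is d_i (m-1).  That entry is the sum of the monomials
   of the closed walks of length d(m-1) at j, and the derivative of a monomial
   along as many arcs is b(F) if its arcs are those of D(F), and 0 otherwise.

   The series converges because b(F) <= c(F), whence mu_d(j) is bounded by
   const * K^d: the number of F and the number of walks are at most exponential
   in d. *)
Require Import Defs.
From mathcomp Require Import all_boot all_order all_algebra.
From mathcomp Require mpoly.
Set Implicit Arguments.
Unset Strict Implicit.
Unset Printing Implicit Defensive.
Import Order.TTheory GRing.Theory Num.Theory.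
Local Open Scope ring_scope.

(** * Eulerian closed walks as arc multisets; product forms of [b] and [c] *)

Lemma path_walk_arcs n (e : rel 'I_n) v s :
  path e v s = all (fun a => e a.1 a.2) (walk_arcs (v :: s)).
Proof. by elim: s v => //= x s IH v; rewrite IH. Qed.

(** A walk inside D(F) uses no foreign arc, so correct multiplicities on the arcs of D(F) fix its
    whole arc multiset; conversely, equal multisets make every step an arc of D(F). *)
Lemma eulerian_closed_walk_perm n m d (F : word_list n m d) v (s : seq 'I_n) :
  eulerian_closed_walk F (v :: s) =
    (last v s == v) && perm_eq (walk_arcs (v :: s)) (arcs F).
Proof.
rewrite /eulerian_closed_walk /= path_walk_arcs -andbA andbCA; congr (_ && _).
have [sF|/allPn[a aw aF]] /= := boolP (all _ _); last first.
  symmetry; apply/negP => /perm_mem/(_ a) e.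
  by move: aF; rewrite -surjective_pairing -e aw.
apply/forallP/idP => [H|/permP H a]; last by apply/implyP => _; apply/eqP/H.
apply/allP => a _ /=.
have := H a; have [//|aF] := boolP (a \in arcs F).
move=> _; rewrite (count_memPn aF); apply/eqP/count_memPn.
by apply: contra aF => /(allP sF); rewrite -surjective_pairing.
Qed.

(** Dropping the fixed starting vertex turns walks into the tuples that index the expansion of a
    power of the auxiliary matrix. *)
Lemma card_W n m d (F : word_list n m d) j :
  #|W F j| = #|[pred w : (d * m.-1).-tuple 'I_n |
     (last j w == j) && perm_eq (walk_arcs (j :: w)) (arcs F)]|.
Proof.
rewrite -!sum1_card.
rewrite [LHS](reindex_onto
  (fun w : (d * m.-1).-tuple 'I_n => [tuple of j :: w])
  (fun w => [tuple of behead w])) /=; last first.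
  move=> w; rewrite inE => /andP[_ /eqP <-].
  by rewrite [RHS]tuple_eta; apply/val_inj.
apply: eq_bigl => w; rewrite !inE theadE eqxx andbT eulerian_closed_walk_perm.
by rewrite (_ : _ == w) ?andbT //; apply/eqP/val_inj.
Qed.

Lemma count_arcs n m d (F : word_list n m d) (P : pred 'I_n) :
  count (fun a => P a.1) (arcs F) = (count P (unzip1 F) * m.-1)%N.
Proof.
rewrite /arcs; case: F => s _ /=; elim: s => //= -[i al] s IH.
rewrite count_cat IH mulnDl count_map (eq_count (a2 := fun=> P i)) //.
congr (_ + _)%N; case: (P i) => /=.
  by rewrite count_predT size_tuple mul1n.
by rewrite count_pred0.
Qed.

Lemma outdegreeE n m d (F : word_list n m d) v :
  outdegree F v = (count_mem v (unzip1 F) * m.-1)%N.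
Proof. exact: count_arcs. Qed.

Lemma c_prod n m d (F : word_list n m d) :
  c F = (\prod_v (outdegree F v)`!)%N.
Proof.
rewrite /c big_mkcond; apply: eq_bigr => v _; case: ifPn => //.
rewrite inE => vF; rewrite /outdegree (_ : count _ _ = 0)%N //.
apply/eqP; rewrite -leqn0 leqNgt -has_count; apply: contra vF.
by apply: sub_has => a /= ->.
Qed.

Lemma b_prod n m d (F : word_list n m d) :
  b F = (\prod_v \prod_u (count_mem (v, u) (arcs F))`!)%N.
Proof.
rewrite /b pair_big big_mkcond /=; apply: eq_bigr => -[v u] _ /=.
by case: ifPn => // /count_memPn ->.
Qed.

Definition edge_word n m (E : {set {set 'I_n}}) :=
  fun t : 'I_n * (m.-1).-tuple 'I_n => word_in E (t.1 :: t.2) && ascending t.2.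

Lemma in_calFH n m d (E : {set {set 'I_n}}) (F : word_list n m d) :
  (F \in calFH m d E) = ascending (unzip1 F) && all (edge_word E) F.
Proof. by rewrite !inE. Qed.

(** * Tuples, ascending words and factorial estimates *)

Lemma big_tuple_cons (V : nmodType) (T : finType) k (P : pred (k.+1.-tuple T))
    (f : k.+1.-tuple T -> V) :
  \sum_(t | P t) f t =
  \sum_(x : T) \sum_(t : k.-tuple T | P [tuple of x :: t]) f [tuple of x :: t].
Proof.
rewrite pair_big_dep /=.
rewrite (reindex (fun p : T * k.-tuple T => [tuple of p.1 :: p.2])) //=.
exists (fun t => (thead t, [tuple of behead t])) => [[x t] _|t _] /=.
  by congr (_, _); apply: val_inj.
by rewrite [RHS]tuple_eta; apply: val_inj.
Qed.

Lemma sum_count_mem (T : finType) (s : seq T) :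
  (\sum_x count_mem x s)%N = size s.
Proof.
elim: s => [|y s IH] /=; first by rewrite big1.
rewrite big_split /= IH (bigD1 y) //= eqxx big1 // => x /negbTE.
by rewrite eq_sym => ->.
Qed.

Lemma leq_ord_trans n : transitive (fun x y : 'I_n => (x <= y)%N).
Proof. by move=> x y z; apply: leq_trans. Qed.

Lemma leq_ord_anti n : antisymmetric (fun x y : 'I_n => (x <= y)%N).
Proof. by move=> x y /anti_leq/val_inj. Qed.

(** The word $1^{d_1}\cdots n^{d_n}$: the order in which [multi_deriv] composes its operators. *)
Definition runs n (ds : 'I_n -> nat) : seq 'I_n :=
  flatten [seq nseq (ds i) i | i <- enum 'I_n].

Lemma count_runs n (ds : 'I_n -> nat) v : count_mem v (runs ds) = ds v.
Proof.
rewrite /runs count_flatten -map_comp sumnE big_map big_enum /=.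
rewrite (bigD1 v) //= count_nseq /= eqxx mul1n big1 ?addn0 // => i /negbTE iv.
by rewrite count_nseq /= iv.
Qed.

Lemma size_runs n (ds : 'I_n -> nat) : size (runs ds) = (\sum_i ds i)%N.
Proof. by rewrite -sum_count_mem; apply: eq_bigr => i _; rewrite count_runs. Qed.

Lemma runs_ascending n (ds : 'I_n -> nat) : ascending (runs ds).
Proof.
rewrite /ascending sorted_pairwise; last exact: leq_ord_trans.
have : pairwise (fun x y : 'I_n => (x <= y)%N) (enum 'I_n).
  rewrite -(pairwise_map val leq) val_enum_ord -sorted_pairwise ?iota_sorted //.
  exact: leq_trans.
rewrite /runs; elim: (enum _) => //= i s IH /andP[/allP is_le /IH {}IH].
rewrite pairwise_cat IH andbT; apply/andP; split.
  apply/allrelP => x y /nseqP[-> _] /flattenP[_ /mapP[k ks ->] /nseqP[-> _]].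
  exact: is_le.
by elim: (ds i) => //= k ->; rewrite andbT all_nseq leqnn orbT.
Qed.

(** A sorted word is determined by its letter counts. Hence exponents $d_1,\dots,d_n$ correspond to
    exactly one word of first letters of an $F$. *)
Lemma ascending_eq_runs n (ds : 'I_n -> nat) (s : seq 'I_n) :
  (s == runs ds) = ascending s && [forall i, count_mem i s == ds i].
Proof.
apply/eqP/andP => [->|[sa /forallP sc]].
  by split; [apply: runs_ascending | apply/forallP => i; rewrite count_runs].
apply: sorted_eq sa (runs_ascending ds) _; first exact: leq_ord_trans.
  exact: leq_ord_anti.
by apply/allP => i _ /=; rewrite count_runs.
Qed.

Lemma card_perm_eq_tuple (T : finType) k (be : k.-tuple T) :
  uniq be -> #|[pred al : k.-tuple T | perm_eq al be]| = k`!.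
Proof.
move=> ube; rewrite -[X in X`!](size_tuple be) -size_permutations //.
rewrite cardE -(size_map val); apply/perm_size/uniq_perm.
- by rewrite (map_inj_uniq val_inj) enum_uniq.
- exact: permutations_uniq.
move=> s; rewrite mem_permutations; apply/mapP/idP => [[al + ->]|sb].
  by rewrite mem_enum inE.
have sz : size s == k by rewrite (perm_size sb) size_tuple.
by exists (Tuple sz); rewrite // mem_enum inE.
Qed.

(** $(x+y)!$ is $x!\,y!$ times a positive binomial coefficient. *)
Lemma prod_fact_leq (I : finType) (f : I -> nat) :
  (\prod_i (f i)`! <= (\sum_i f i)`!)%N.
Proof.
apply: (big_ind2 (fun x y => x <= y`!)%N) => // x1 y1 x2 y2 le1 le2.
apply: leq_trans (leq_mul le1 le2) _.
rewrite -(bin_fact (leq_addr y2 y1)) addKn leq_pmull //.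
by rewrite bin_gt0 leq_addr.
Qed.

Lemma sum_count_fst (T U : finType) (v : T) (s : seq (T * U)) :
  (\sum_u count_mem (v, u) s)%N = count (fun a => a.1 == v) s.
Proof.
elim: s => [|[x y] s IH] /=; first by rewrite big1.
rewrite big_split /= IH; congr (_ + _)%N; case: (eqVneq x v) => [->|xv].
  rewrite (bigD1 y) //= eqxx big1 // => u uy.
  by rewrite xpair_eqE eqxx eq_sym (negbTE uy).
by rewrite big1 // => u _; rewrite xpair_eqE (negbTE xv).
Qed.

(** The outdegree of $v$ is the sum of the multiplicities of the arcs leaving $v$, so the factorials
    compare vertex by vertex. *)
Lemma leq_b_c n m d (F : word_list n m d) : (b F <= c F)%N.
Proof.
rewrite b_prod c_prod; apply: leq_prod => v _.
by rewrite /outdegree -sum_count_fst prod_fact_leq.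
Qed.

(** A walk of positive length from $j$ has a first arc, which makes $j$ a vertex of D(F). For length
    0 this fails, as D(F) is empty. *)
Lemma W_eulerian n m d (F : word_list n m d) j w :
  (0 < d * m.-1)%N -> w \in W F j -> eulerian F && (j \in vertices F).
Proof.
move=> N_gt0; rewrite inE => /andP[wE /eqP wj].
apply/andP; split; first by apply/existsP; exists w.
case/tupleP: w wE wj => v s; rewrite theadE => + vj; rewrite {v}vj inE /=.
rewrite eulerian_closed_walk_perm => /andP[_ /perm_mem].
case: (tval s) (size_tuple s) => [sz|x s' _]; first by rewrite -sz in N_gt0.
move=> /(_ (j, x)).
by rewrite inE eqxx /= => jF; apply/hasP; exists (j, x); rewrite //= eqxx.
Qed.

(** * Monomials of walks and their derivatives *)

Module Calculus.
Import mpoly DiffOp.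

Section Calculus.
Variable n : nat.
Implicit Types (s t : seq ('I_n * 'I_n)).

(** Encodes an arc multiset both as a monomial in the $a_{ij}$ and as a mixed partial derivative. *)
Definition arc_mnm s : 'X_{1..n * n} :=
  (\sum_(a <- s) U_(mxvec_index a.1 a.2))%MM.

Lemma mxvec_index_eq (i i' j j' : 'I_n) :
  (mxvec_index i j == mxvec_index i' j') = ((i, j) == (i', j')).
Proof.
apply/eqP/eqP => [|[-> -> //]] e.
have [g gK _] := curry_mxvec_bij n n.
by rewrite -(gK (i, j)) ?inE // -(gK (i', j')) ?inE //= e.
Qed.

Lemma arc_mnmE s i j : arc_mnm s (mxvec_index i j) = count_mem (i, j) s.
Proof.
rewrite /arc_mnm mnm_sumE -sum1_count [RHS]big_mkcond /=.
apply: eq_bigr => -[x y] _.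
by rewrite mnm1E mxvec_index_eq; case: eqP.
Qed.

Lemma arc_mnm_eq s t : (arc_mnm s == arc_mnm t) = perm_eq s t.
Proof.
apply/eqP/idP => [e|st]; last exact: perm_big.
by apply/allP => -[i j] _ /=; rewrite -!arc_mnmE e.
Qed.

Lemma arc_mnm_cat s t : arc_mnm (s ++ t) = (arc_mnm s + arc_mnm t)%MM.
Proof. exact: big_cat. Qed.

Variable R : fieldType.
Implicit Types (p : {mpoly R[n * n]}).

Lemma word_derivE i alpha p :
  word_deriv i alpha p = mderivm (arc_mnm [seq (i, k) | k <- alpha]) p.
Proof.
rewrite /arc_mnm big_map; elim: alpha => [|x al IH] /=.
  by rewrite big_nil mderivm0m.
by rewrite big_cons addmC mderivmDm mderivmU1m IH.
Qed.

Lemma aux_matrix_expE k i j :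
  (aux_matrix R n ^+ k) i j =
  \sum_(w : k.-tuple 'I_n | last i w == j) 'X_[arc_mnm (walk_arcs (i :: w))].
Proof.
elim: k i => [|k IH] i.
  rewrite expr0 mxE; case: eqP => [->|/eqP ne].
    rewrite (big_pred1 [tuple]) => [|w]; last by rewrite !tuple0 /= !eqxx.
    by rewrite /arc_mnm /= big_nil mpolyX0.
  by rewrite big_pred0 // => w; rewrite tuple0 /=; apply/negbTE.
rewrite exprS mxE big_tuple_cons; apply: eq_bigr => l _.
rewrite IH mulr_sumr mxE; apply: eq_bigr => w _.
by rewrite -mpolyXD /arc_mnm /= big_cons.
Qed.

(** The constant term after differentiating along an exponent is the coefficient of that monomial
    times the product of the factorials of its exponents. The coefficient counts walks, the product
    is [b F]. *)
Lemma mcoeff0_arc_deriv m d (F : word_list n m d) j :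
  mcoeff 0%MM (mderivm (arc_mnm (arcs F)) ((aux_matrix R n ^+ (d * m.-1)) j j))
  = (b F * #|W F j|)%:R.
Proof.
rewrite mcoeff_mderivm addm0 aux_matrix_expE raddf_sum /=.
rewrite [(b F * _)%N]mulnC mulrnA.
congr (_ *+ _); last first.
  (* Each factor is the falling factorial of a multiplicity by itself, hence its factorial. *)
  rewrite b_prod pair_big (reindex _ (curry_mxvec_bij n n)) /=.
  apply: eq_bigr => -[u v] _ /=.
  by rewrite arc_mnmE ffactnn.
rewrite card_W -sum1_card natr_sum /= [LHS]big_mkcond [RHS]big_mkcond /=.
apply: eq_bigr => w _; rewrite mcoeffX arc_mnm_eq inE.
by case: eqP => //=; case: perm_eq.
Qed.

End Calculus.

(** * Expansion of the differential operators over lists of edge words *)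

Section Expansion.
Variables (R : numFieldType) (n m : nat) (E : {set {set 'I_n}}).
Hypothesis hE : uniform_hypergraph m E.
Implicit Types (p : {mpoly R[n * n]}).

Lemma word_in_perm (i : 'I_n) (al be : seq 'I_n) :
  perm_eq al be -> word_in E (i :: al) = word_in E (i :: be).
Proof.
move=> /perm_mem ab; congr (_ \in E); apply/setP => x.
by rewrite !inE ab.
Qed.

Lemma word_in_uniq (w : seq 'I_n) : size w = m -> word_in E w -> uniq w.
Proof.
by move=> sw /(hE.2); rewrite cardsE => cw; apply/card_uniqP; rewrite sw.
Qed.

Lemma fact_neq0 k : k`!%:R != 0 :> R.
Proof. by rewrite pnatr_eq0 -lt0n fact_gt0. Qed.

(** Words are grouped by their sorted rearrangement, on which both the tensor entry and the
    derivative depend only. *)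
Lemma tensor_deriv_adjacency i p :
  tensor_deriv (@adjacency_tensor R n m E) i p =
  \sum_(al : (m.-1).-tuple 'I_n | word_in E (i :: al) && ascending al)
     mderivm (arc_mnm [seq (i, k) | k <- al]) p.
Proof.
pose r (x y : 'I_n) := (x <= y)%N.
have r_tot : total r by move=> x y; apply: leq_total.
have r_tr : transitive r := @leq_ord_trans n.
have r_anti : antisymmetric r := @leq_ord_anti n.
rewrite /tensor_deriv.
rewrite (partition_big (fun al : (m.-1).-tuple 'I_n => [tuple of sort r al])
           (fun be : (m.-1).-tuple 'I_n => ascending be)) /=; last first.
  by move=> al _; apply: sort_sorted.
rewrite big_mkcond [RHS]big_mkcond /=; apply: eq_bigr => be _.
rewrite andbC; case: ifP => //= be_s.
rewrite (eq_bigl (fun al : (m.-1).-tuple 'I_n => perm_eq al be)); last first.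
  move=> al; rewrite -val_eqE /= -[X in _ == X](sorted_sort r_tr be_s).
  exact/eqP/(perm_sortP r_tot r_tr r_anti).
rewrite (eq_bigr (fun=> adjacency_tensor R E i be *:
           mderivm (arc_mnm [seq (i, k) | k <- be]) p)); last first.
  move=> al ab; rewrite /adjacency_tensor (word_in_perm i ab) word_derivE.
  by rewrite (eqP (_ : arc_mnm _ == arc_mnm [seq (i, k) | k <- be]))
             ?arc_mnm_eq ?perm_map.
rewrite sumr_const /adjacency_tensor; case: ifP => [be_in|_].
  have /andP[_ ube] : uniq (i :: be).
    (* $m\ge 2$ ensures that [m.-1.+1] is $m$, so the word has as many letters as its edge has
       elements. *)
    by apply: word_in_uniq => //=; rewrite size_tuple; case: m (hE.1).
  rewrite (card_perm_eq_tuple ube) scalerMnl -mulr_natr.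
  by rewrite mulVf ?scale1r // fact_neq0.
by rewrite scale0r mul0rn.
Qed.

(** Expanding the composition chooses one ascending word per operator; composing derivatives adds
    exponents, that is, concatenates arc lists. *)
Lemma foldr_tensor_deriv d (I : d.-tuple 'I_n) p :
  foldr (tensor_deriv (@adjacency_tensor R n m E)) p I =
  \sum_(F : word_list n m d | (unzip1 F == I) && all (edge_word E) F)
    mderivm (arc_mnm (arcs F)) p.
Proof.
elim: d I => [|d IH] I.
  rewrite tuple0 (big_pred1 [tuple]) => [|F]; last by rewrite tuple0 /= eqxx.
  by rewrite /arc_mnm big_nil mderivm0m.
case/tupleP: I => i I /=; rewrite IH tensor_deriv_adjacency big_tuple_cons.
rewrite -(pair_bigA _ (fun x al => \sum_(F : word_list n m d |
   (unzip1 [tuple of (x, al) :: F] == i :: I) &&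
   all (edge_word E) [tuple of (x, al) :: F])
   mderivm (arc_mnm (arcs [tuple of (x, al) :: F])) p)) /=.
(* Only pairs with first component [i] can head a list whose first letters are [i :: I]. *)
rewrite (bigD1 i) //= [X in _ = _ + X]big1 ?addr0 => [|x ne]; last first.
  apply: big1 => al _; apply: big_pred0 => F.
  by rewrite /= eqseq_cons (negbTE ne).
rewrite [LHS]big_mkcond /=; apply: eq_bigr => al _.
case: ifP => gal; last first.
  by rewrite big_pred0 // => F; rewrite /= /edge_word /= gal andbF.
rewrite raddf_sum /=; apply: eq_big => [F|F _].
  by rewrite /= eqseq_cons eqxx /= /edge_word /= gal.
by rewrite -mderivmDm addmC -arc_mnm_cat.
Qed.

Lemma multi_derivE (h : tensor R n m) ds p :
  multi_deriv h ds p = (\prod_i (ds i * m.-1)`!)%:R^-1 *: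
    foldr (tensor_deriv h) p (runs ds).
Proof.
have tZ i c q : tensor_deriv h i (c *: q) = c *: tensor_deriv h i q.
  rewrite /tensor_deriv scaler_sumr; apply: eq_bigr => al _.
  by rewrite !word_derivE mderivmZ !scalerA mulrC.
rewrite /multi_deriv /runs -big_enum /=; elim: (enum _) => [|i s IH] /=.
  by rewrite big_nil invr1 scale1r.
rewrite big_cons natrM invfM -scalerA IH foldr_cat; congr (_ *: _).
set q := foldr _ _ _; elim: (ds i) => [//|e IHe] /=.
by rewrite IHe tZ.
Qed.

(** The lists $F$ are sorted by the counts $d_i$ of their first letters; on each class $c(F)$ is the
    constant $\prod_i (d_i(m-1))!$. *)
Lemma mu_sum_adjacency d j :
  mu_sum (@adjacency_tensor R n m E) d j =
  \sum_(F in calFH m d E) (b F)%:R / (c F)%:R * #|W F j|%:R.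
Proof.
rewrite /mu_sum /mu_poly raddf_sum /=.
rewrite [RHS](partition_big
  (fun F : word_list n m d =>
     [ffun i => inord (count_mem i (unzip1 F))] : {ffun 'I_n -> 'I_d.+1})
  (fun ds : {ffun 'I_n -> 'I_d.+1} => (\sum_i ds i)%N == d)) /=; last first.
  move=> F _; rewrite -[X in _ == X](size_tuple F) -(size_map fst).
  rewrite -sum_count_mem.
  (* A count is at most the length $d$, so [inord] does not truncate it. *)
  apply/eqP/eq_bigr => i _; rewrite ffunE inordK // ltnS.
  by rewrite (leq_trans (count_size _ _)) // size_map size_tuple.
apply: eq_bigr => ds /eqP ds_sum; rewrite multi_derivE mcoeffZ.
pose dn (i : 'I_n) : nat := ds i.
have sz : size (runs dn) == d by rewrite size_runs ds_sum.
rewrite -[X in foldr _ _ X]/(val (Tuple sz)) foldr_tensor_deriv.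
rewrite raddf_sum mulr_sumr /=; apply: eq_big => [F|F /andP[/eqP Fds _]].
  rewrite in_calFH ascending_eq_runs andbAC; congr (_ && _ && _).
  apply/forallP/eqP => [H|e i].
    by apply/ffunP => i; rewrite ffunE (eqP (H i)) /dn inord_val.
  rewrite /dn -e ffunE inordK // ltnS.
  by rewrite (leq_trans (count_size _ _)) // size_map size_tuple.
rewrite mcoeff0_arc_deriv natrM mulrA; congr (_ * _); rewrite mulrC.
congr (_ / _%:R); rewrite c_prod; apply: eq_bigr => i _.
by rewrite outdegreeE Fds count_runs.
Qed.

End Expansion.

End Calculus.

From mathcomp Require Import all_classical all_reals all_analysis.
Import GRing.Theory Num.Theory numFieldNormedType.Exports.
Import finset.
Local Open Scope classical_set_scope.
Local Open Scope ring_scope.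

(** * Bounds on [mu], convergence and the final formula *)

Lemma muE (R : realType) (n m d : nat) (E : {set {set 'I_n}}) (j : 'I_n) :
  uniform_hypergraph m E ->
  mu R m E d j = (m.-1)%:R ^+ n.-1 *
    \sum_(F in calFH m d E) (b F)%:R / (c F)%:R * #|W F j|%:R.
Proof. by move=> hE; rewrite /mu Calculus.mu_sum_adjacency. Qed.

Lemma mu_ge0 (R : realType) (n m d : nat) (E : {set {set 'I_n}}) (j : 'I_n) :
  uniform_hypergraph m E -> 0 <= mu R m E d j.
Proof.
move=> hE; rewrite muE //; apply: mulr_ge0; first exact: exprn_ge0.
by apply: sumr_ge0 => F _; rewrite !mulr_ge0 ?invr_ge0.
Qed.

(** There are at most $(n\cdot n^{m-1})^d$ lists $F$, each with $b(F)/c(F)\le 1$ and at most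
    $n^{d(m-1)+1}$ walks; the extra factor $n$ comes from the starting vertex. *)
Lemma mu_le (R : realType) (n m d : nat) (E : {set {set 'I_n}}) (j : 'I_n) :
  uniform_hypergraph m E ->
  mu R m E d j <= (m.-1)%:R ^+ n.-1 * n%:R *
                  (n * n ^ m.-1 * n ^ m.-1)%:R ^+ d.
Proof.
move=> hE; rewrite muE // -mulrA; apply: ler_wpM2l; first exact: exprn_ge0.
have term (F : word_list n m d) :
    (b F)%:R / (c F)%:R * #|W F j|%:R <= (n ^ (d * m.-1).+1)%:R :> R.
  rewrite -[leRHS]mul1r; apply: ler_pM; rewrite ?divr_ge0 //.
    rewrite ler_pdivrMr ?mul1r ?ler_nat ?leq_b_c // ltr0n c_prod.
    by rewrite prodn_gt0 // => v; apply: fact_gt0.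
  by rewrite ler_nat (leq_trans (max_card _)) // card_tuple card_ord.
apply: le_trans (ler_sum _ (fun F _ => term F)) _.
rewrite sumr_const -[leLHS]mulr_natl -natrM -natrX -natrM ler_nat.
apply: leq_trans (leq_mul (max_card _) (leqnn _)) _.
rewrite card_tuple card_prod card_ord card_tuple card_ord.
rewrite expnS mulnC -mulnA leq_mul2l [(d * _)%N]mulnC expnM -expnMn.
by rewrite [(_ ^ _ * _)%N]mulnC leqnn orbT.
Qed.

Theorem theorem4p2 (R : realType) (n m : nat) (E : {set {set 'I_n}})
    (hE : uniform_hypergraph m E) (j : 'I_n) :
  series (fun d : nat => mu R m E d j / d`!%:R) @ \oo
    --> subgraph_centrality R m E j
  /\ mu R m E 0%N j = (m.-1)%:R ^+ n.-1
  /\ forall d : nat, (1 <= d)%N ->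
       mu R m E d j =
         (m.-1)%:R ^+ n.-1 *
         \sum_(F in calFHj m d E j) (b F)%:R / (c F)%:R * #|W F j|%:R.
Proof.
(* For $d=0$ the only list is empty and its only walk is the single vertex $j$. *)
have mu0 : mu R m E 0 j = (m.-1)%:R ^+ n.-1.
  rewrite muE // (big_pred1 [tuple]) => [|F]; last first.
    by rewrite tuple0 in_calFH /= eqxx.
  have -> : b ([tuple] : word_list n m 0) = 1%N.
    by rewrite b_prod big1 // => v _; rewrite big1.
  have -> : c ([tuple] : word_list n m 0) = 1%N by rewrite c_prod big1.
  rewrite card_W (@fintype.eq_card1 _ [tuple]) => [|w]; last first.
    by rewrite !inE [w]tuple0 /= !eqxx.
  by rewrite divr1 !mulr1.
split; last first.
  split=> // d d_gt0; rewrite muE //; congr (_ * _).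
  rewrite big_mkcond [RHS]big_mkcond /=; apply: eq_bigr => F _.
  rewrite [F \in calFHj _ _ _ _]inE; case: (F \in _) => //=.
  case: ifPn => // nE.
  (* Lists outside [calFHj] admit no walk from $j$ and contribute 0. *)
  suff -> : #|W F j| = 0%N by rewrite mulr0.
  apply: contraNeq nE; rewrite -lt0n => /card_gt0P[w wF]; apply: W_eulerian wF.
  by rewrite muln_gt0 d_gt0 -subn1 subn_gt0 hE.1.
(* [subgraph_centrality] is the [limn] of this series, so convergence suffices; it follows by
   comparison with a multiple of the exponential series. *)
apply: (@series_le_cvg _ _
  (((m.-1)%:R ^+ n.-1 * n%:R) *: exp_coeff (n * n ^ m.-1 * n ^ m.-1)%:R)).
- by move=> d; rewrite divr_ge0 ?mu_ge0.
- by move=> d; rewrite /= mulr_ge0 ?exp_coeff_ge0 // mulr_ge0 ?exprn_ge0.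
- move=> d; rewrite /exp_coeff /= [leRHS]mulrA ler_wpM2r ?invr_ge0 //.
  exact: mu_le.
exact/is_cvg_seriesZ/is_cvg_series_exp_coeff.
Qed.
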